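(* For any $k$-edge-connected graph $G=(V,E)$ (and any destination $t\in V$), there exists a $\left\lfloor \frac{k}{2}\right\rfloor$-resilient routing scheme against dynamic failures.
   Context: Graphs are finite undirected multigraphs; connectivity is edge-connectivity. Dynamic failures: a set $F\subseteq E$ of unstable links; each link of $F$ may alternate arbitrarily between up and down over time (when down it fails in both directions), including while a packet travels; links outside $F$ are always up. Routing scheme: for destination $t$, every node $v\ne t$ has a static deterministic forwarding function whose input is the in-port of the packet (or $\bot$ if the packet originates at $v$) and the set of links incident to $v$ that are currently up, and whose output is an outgoing link at $v$. No packet header rewriting and no knowledge of the source is used. A routing scheme for $t$ is $r$-resilient against dynamic failures if for every set $F$ of dynamic failures with $|F|\le r$, every packet originating at a node $s$ that is connected to $t$ in $G\setminus F$ (the graph with all of $F$ removed) is delivered to $t$, however the states of the links of $F$ evolve. *)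

(* Defs.v *)
From mathcomp Require Import all_boot.

Set Implicit Arguments.
Unset Strict Implicit.
Unset Printing Implicit Defensive.

(* The pair [ends e] is read as unordered: links are undirected.  Parallel
   links are distinct elements of [link]; self-loops are not excluded. *)
Record multigraph := Multigraph {
  vertex : finType;
  link : finType;
  ends : link -> vertex * vertex
}.

Definition joins (G : multigraph) (e : link G) (u v : vertex G) : bool :=
  (ends e == (u, v)) || (ends e == (v, u)).

Definition links_at (G : multigraph) (v : vertex G) : {set link G} :=
  [set e | (v == (ends e).1) || (v == (ends e).2)].

Definition adj_without (G : multigraph) (F : {set link G}) : rel (vertex G) :=
  fun u v => [exists e, (e \notin F) && joins e u v].

Definition connected_without (G : multigraph) (F : {set link G})
    (u v : vertex G) : bool :=
  connect (adj_without F) u v.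

Definition k_edge_connected (k : nat) (G : multigraph) : Prop :=
  forall F : {set link G}, #|F| < k ->
  forall u v : vertex G, connected_without F u v.

(* [forward v p U] is the link chosen at [v] for a packet with in-port [p]
   ([None] if the packet originates at [v]) when [U] is the set of links
   incident to [v] that are up.  A node without any link has nothing to
   output; this is the only reason for the option in the codomain. *)
Record routing_scheme (G : multigraph) (t : vertex G) := RoutingScheme {
  forward : vertex G -> option (link G) -> {set link G} -> option (link G);
  forward_link : forall v p U, v != t -> links_at v != set0 ->
    exists2 e, e \in links_at v & forward v p U = Some e
}.

(* [up i] is the set of links of [G] that are up when the packet makes its
   [i]-th hop.  [delivered R up i v p] : a packet that is at [v] with in-port
   [p] after [i] hops reaches [t] in finitely many further hops.  A packet
   forwarded to a link that is down is lost. *)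
Inductive delivered (G : multigraph) (t : vertex G) (R : routing_scheme t)
    (up : nat -> {set link G}) :
    nat -> vertex G -> option (link G) -> Prop :=
| Arrived i p : delivered R up i t p
| Hop i v w p e :
    v != t ->
    forward R v p (links_at v :&: up i) = Some e ->
    e \in up i ->
    joins e v w ->
    delivered R up i.+1 w (Some e) ->
    delivered R up i v p.

Definition dynamically_resilient (r : nat) (G : multigraph) (t : vertex G)
    (R : routing_scheme t) : Prop :=
  forall F : {set link G}, #|F| <= r ->
  forall up : nat -> {set link G}, (forall i, ~: F \subset up i) ->
  forall s : vertex G, connected_without F s t ->
  delivered R up 0 s None.

(* Main.v *)
Require Import Defs.
From mathcomp Require Import all_boot zify.

Set Implicit Arguments.
Unset Strict Implicit.
Unset Printing Implicit Defensive.

(** By Edmonds' branching theorem, the bidirected graph has k pairwise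
    arc-disjoint in-branchings T_0, ..., T_(k-1) towards t, so the in-port tells
    on which branching a packet travels.  A packet starts on T_0; when its next
    arc on T_i is down it moves on to the first later branching whose arc is up,
    and when there is none and T_(k-1) fails at an arc a, it bounces to the
    branching containing the reverse of a.  A branching that avoids F, if there
    is one, is reached and never left.  Otherwise, since F carries at most k
    arcs, each branching contains exactly one arc over F and each arc over F is
    in exactly one branching.  Hence the branching T_j containing the reverse of
    a has no other arc over F, and its path to t from the tail v of a does not
    use that arc, which enters v. *)

(** * Edmonds' theorem on arc-disjoint in-branchings *)

Section ArcDisjointBranchings.

Variables (V A : finType) (src tgt : A -> V) (R : {set V}).
Implicit Types (B T : {set A}) (S X Y Z : {set V}).

Definition leaving B X : {set A} :=
  [set a in B | (src a \in X) && (tgt a \notin X)].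

Lemma card_leaving B X :
  #|leaving B X| = \sum_(a in B) ((src a \in X) && (tgt a \notin X)).
Proof.
rewrite -sum1_card big_mkcond [RHS]big_mkcond; apply: eq_bigr => a _.
by rewrite inE; case: (a \in B); case: (src a \in X); case: (tgt a \in X).
Qed.

Lemma leaving_submodular B X Y :
  #|leaving B (X :&: Y)| + #|leaving B (X :|: Y)| <=
  #|leaving B X| + #|leaving B Y|.
Proof.
rewrite !card_leaving -!big_split; apply: leq_sum => a _ /=; rewrite !inE.
by case: (src a \in X); case: (tgt a \in X);
   case: (src a \in Y); case: (tgt a \in Y).
Qed.

(** Edmonds' cut condition for in-branchings, with [R] acting as a single contracted root. *)
Definition rooted_connected k B :=
  forall X, X != set0 -> [disjoint X & R] -> k <= #|leaving B X|.

(** Deleting one arc can break the condition only at a set which that arc leaves and which exactly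
    [k] arcs leave in all. *)
Lemma rooted_connectedD1 k B a :
    rooted_connected k B ->
    (forall Z, [disjoint Z & R] -> a \in leaving B Z -> #|leaving B Z| != k) ->
  rooted_connected k (B :\ a).
Proof.
move=> conB ntight Z Z0 ZR.
have -> : leaving (B :\ a) Z = leaving B Z :\ a.
  by apply/setP=> b; rewrite !inE -andbA.
have := conB Z Z0 ZR; have := ntight Z ZR; have := cardsD1 a (leaving B Z).
case: (a \in _) => /= -> => [/(_ isT)|_]; last by rewrite add0n.
by rewrite add1n [_ == k]eq_sym leq_eqVlt => /negPf ->.
Qed.

(* Lovasz: take a minimal set X that is V or is tight after the removal of T
   and not inside S.  No arc of T leaves X \ S, so more arcs leave X \ S than
   X, and one of them goes from X \ S to S within X.  A tight Z that it leaves
   would uncross with X to a smaller such set. *)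
Lemma branching_extend k B T S :
    rooted_connected k.+1 B -> rooted_connected k (B :\: T) ->
    R \subset S -> S != setT -> {in T, forall a, src a \in S} ->
  exists a, [/\ a \in B :\: T, src a \notin S, tgt a \in S &
                rooted_connected k (B :\: T :\ a)].
Proof.
move=> conB; move defD: (B :\: T) => D conD RS SnT srcT.
pose tight X := [&& [disjoint X & R], #|leaving D X| == k & ~~ (X \subset S)].
pose P X := (X == setT) || tight X.
have [X /minsetP[PX minX]] : {X | minset P X}.
  by apply: ex_minset; exists setT; rewrite /P eqxx.
have XnS : ~~ (X \subset S).
  by case/orP: PX => [/eqP->|/and3P[]//]; rewrite subTset.
have leX : #|leaving D X| <= k.
  case/orP: PX => [/eqP->|/and3P[_ /eqP->]//].
  suff -> : leaving D setT = set0 by rewrite cards0.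
  by apply/setP=> a; rewrite !inE andbF.
have ltk : k < #|leaving D (X :\: S)|.
  have -> : leaving D (X :\: S) = leaving B (X :\: S).
    apply/setP=> a; rewrite -defD !inE; case: (boolP (a \in T)) => //= /srcT ->.
    by rewrite /= andbF.
  apply: conB; first by rewrite setD_eq0.
  rewrite disjoint_sym disjoints_subset; apply: subset_trans RS _.
  by apply/subsetP=> v vS; rewrite !inE vS.
have [a] : exists a, a \in leaving D (X :\: S) :\: leaving D X.
  apply/set0Pn; rewrite setD_eq0; apply/negP => /subset_leq_card; lia.
case/setDP; rewrite !inE => /and3P[aD /andP[anS aX] tXS].
rewrite aD aX negbK /= => tX; move: tXS; rewrite tX andbT negbK => tS.
exists a; split=> //; apply: rooted_connectedD1 => // Z ZR.
rewrite inE aD /= => /andP[aZ tZ]; apply/negP => kZ.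
suff PXZ : P (X :&: Z).
  by move: tX; rewrite -(minX _ PXZ (subsetIl _ _)) inE (negPf tZ) andbF.
have XZnS : ~~ (X :&: Z \subset S).
  apply/negP => /subsetP/(_ (src a)).
  by rewrite !inE aX aZ (negPf anS) => /(_ isT).
apply/orP; right; case/orP: PX => [/eqP XT|/and3P[XR kX _]].
  by move: XZnS; rewrite XT setTI => ZnS; apply/and3P.
have XZR : [disjoint X :&: Z & R] by apply: disjointWl ZR; apply: subsetIr.
apply/and3P; split=> //; rewrite eqn_leq conD ?andbT //; last first.
  by apply/set0Pn; exists (src a); rewrite inE aX.
have : k <= #|leaving D (X :|: Z)|.
  apply: conD; first by apply/set0Pn; exists (src a); rewrite inE aX.
  by rewrite disjoints_subset subUset -!disjoints_subset XR.
have := leaving_submodular D X Z; rewrite (eqP kX) (eqP kZ); lia.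
Qed.

(* Acyclicity of a branching is witnessed by a height that strictly decreases
   along its arcs. *)
Definition spanning_branching T (h : V -> nat) :=
  {in T, forall a, h (tgt a) < h (src a)} /\
  (forall v, v \notin R -> exists2 a, a \in T & src a = v).

Lemma branching_exists k B :
    rooted_connected k.+1 B ->
  exists T h, [/\ T \subset B, spanning_branching T h &
                  rooted_connected k (B :\: T)].
Proof.
move=> conB.
(* [S] collects the vertices already spanned by the partial branching [T]; [n] bounds the number
   still missing. *)
suff grow n S T (h : V -> nat) : #|~: S| < n ->
    R \subset S -> T \subset B -> rooted_connected k (B :\: T) ->
    {in T, forall a, [/\ src a \in S, tgt a \in S & h (tgt a) < h (src a)]} ->
    (forall v, v \in S -> v \notin R -> exists2 a, a \in T & src a = v) ->
    exists T h, [/\ T \subset B, spanning_branching T h &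
                    rooted_connected k (B :\: T)].
  apply: (grow _ R set0 (fun=> 0)) (ltnSn _) _ _ _ _ _; rewrite ?sub0set //.
  - move=> X X0 XR; rewrite setD0; exact: ltnW (conB X X0 XR).
  - by move=> a; rewrite inE.
  - by move=> v ->.
elim: n S T h => // n IHn S T h leSn RS TB conD inT covS.
case: (eqVneq S setT) => [ST|SnT].
  exists T, h; split=> //; split=> [a /inT[]//|v]; apply: covS.
  by rewrite ST inE.
have [|a [aD anS tS conDa]] := branching_extend conB conD RS SnT.
  by move=> a /inT[].
have neq u : u \in S -> (u == src a) = false.
  by move=> uS; apply: contraNF anS => /eqP <-.
(* The new vertex is placed one above the head of its arc; heights on [S] do not change. *)
apply: (IHn (src a |: S) (a |: T)
  (fun v => if v == src a then (h (tgt a)).+1 else h v)).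
- have := cardsD1 (src a) (~: S); rewrite inE anS setDE -setCU setUC; lia.
- exact: subset_trans RS (subsetUr _ _).
- by rewrite subUset TB sub1set andbT; move: aD; rewrite inE => /andP[].
- by rewrite setUC -setDDl.
- move=> b; rewrite !inE => /orP[/eqP->|/inT[sb tb ltb]].
    by rewrite eqxx tS orbT neq.
  by rewrite sb tb !orbT !neq.
- move=> v; rewrite !inE => /orP[/eqP->|vS] vR.
    by exists a; rewrite ?setU11.
  by have [b bT <-] := covS v vS vR; exists b; rewrite // inE bT orbT.
Qed.

Lemma disjoint_branchings k B :
    rooted_connected k B ->
  exists (T : nat -> {set A}) (h : nat -> V -> nat),
    [/\ forall i, i < k -> T i \subset B,
        forall i, i < k -> spanning_branching (T i) (h i) &
        forall i j a, i < k -> j < k -> a \in T i -> a \in T j -> i = j].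
Proof.
elim: k B => [|k IHk] B conB; first by exists (fun=> set0), (fun=> fun=> 0).
have [T0 [h0 [T0B br0 /IHk[T [h [TB brT disT]]]]]] := branching_exists conB.
exists (fun i => if i is j.+1 then T j else T0),
       (fun i => if i is j.+1 then h j else h0).
have notT0 i a : i < k -> a \in T i -> a \notin T0.
  by move=> ltik /(subsetP (TB i ltik)); rewrite inE => /andP[].
split=> [[|i] // ltik|[|i] // ltik|[|i] [|j] a //= ltik ltjk].
- exact: subset_trans (TB i ltik) (subsetDl _ _).
- exact: brT.
- by move=> aT0 /(notT0 _ _ ltjk); rewrite aT0.
- by move=> /(notT0 _ _ ltik)/negPf ->.
- by move=> aTi aTj; rewrite (disT i j a).
Qed.

End ArcDisjointBranchings.

(** * The routing scheme built from the branchings *)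

Section Routing.

Variables (G : multigraph) (t : vertex G).

Definition arc : finType := (link G * bool)%type.
Definition reverse (a : arc) : arc := (a.1, ~~ a.2).
Definition tail (a : arc) : vertex G :=
  if a.2 then (ends a.1).1 else (ends a.1).2.
Definition head (a : arc) : vertex G := tail (reverse a).

Lemma reverseK : involutive reverse.
Proof. by case=> e b; rewrite /reverse /= negbK. Qed.

Lemma head_reverse a : head (reverse a) = tail a.
Proof. by rewrite /head reverseK. Qed.

Lemma joins_arc a : joins a.1 (tail a) (head a).
Proof.
case: a => e b; rewrite /joins /head /tail /=.
by case: (ends e) b => u v [] /=; rewrite eqxx ?orbT.
Qed.

Lemma arc_of_joins (e : link G) u v :
  joins e u v -> exists a, [/\ a.1 = e, tail a = u & head a = v].
Proof.
by case/orP=> /eqP E; [exists (e, true) | exists (e, false)];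
   rewrite /head /tail /= E.
Qed.

Lemma link_of_tail a : a.1 \in links_at (tail a).
Proof. by rewrite inE /tail; case: a.2; rewrite eqxx ?orbT. Qed.

(** An in-port is a link without direction; the receiving vertex restores the direction, except at a
    self-loop, whose two arcs share their head. *)
Lemma eq_arc_head a b :
  a.1 = b.1 -> head a = head b -> tail a != head a -> a = b.
Proof.
case: a b => [e x] [e' y] /= <-; rewrite /head /tail /=.
by case: x; case: y => //= ->; rewrite eqxx.
Qed.

Lemma adj_withoutP (F : {set link G}) (u v : vertex G) :
  reflect (exists a : arc, [/\ a.1 \notin F, tail a = u & head a = v])
          (adj_without F u v).
Proof.
apply: (iffP existsP) => [[e /andP[eF /arc_of_joins[a [ae <- <-]]]]|].
  by exists a; rewrite ae.
by case=> a [aF <- <-]; exists a.1; rewrite aF joins_arc.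
Qed.

Variables (R : {set vertex G}) (K : nat).
Variables (T : nat -> {set arc}) (h : nat -> vertex G -> nat).

Definition tree_arc i v : option arc := [pick a in T i | tail a == v].

Definition available (U : {set link G}) v i : bool :=
  if tree_arc i v is Some a then a.1 \in U else false.

(** The value is [K] when no index below [K] satisfies [P]; [next_tree] tests for this before
    bouncing. *)
Definition first_tree (P : pred nat) : nat := find P (iota 0 K).

(* The in-port [e] of a packet at [v] determines the arc along which the packet
   came, hence its current tree. *)
Definition current_tree v (p : option (link G)) : nat :=
  if p is Some e
  then first_tree (fun i => [exists a in T i, (a.1 == e) && (head a == v)])
  else 0.

Definition bounce_tree v : nat :=
  if tree_arc K.-1 v is Some a then first_tree (fun i => reverse a \in T i)
  else 0.

Definition next_tree v p U : nat :=
  let i := first_tree (fun i => (current_tree v p <= i) && available U v i) in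
  if i < K then i else bounce_tree v.

(** The arbitrary link is a filler where the chosen tree has no arc: [forward_link] asks for an
    output at every node other than [t] that has a link. *)
Definition tree_forward v p U : option (link G) :=
  if tree_arc (next_tree v p U) v is Some a then Some a.1
  else [pick e in links_at v].

Lemma tree_arc_some i v a : tree_arc i v = Some a -> a \in T i /\ tail a = v.
Proof.
by rewrite /tree_arc; case: pickP => // b /andP[bT /eqP bv] [<-].
Qed.

Lemma tree_forward_link v p U : v != t -> links_at v != set0 ->
  exists2 e, e \in links_at v & tree_forward v p U = Some e.
Proof.
move=> _ /set0Pn[e ev]; rewrite /tree_forward.
case E: tree_arc => [a|].
  by have [_ <-] := tree_arc_some E; exists a.1; rewrite ?link_of_tail.
by case: pickP => [e' ev'|/(_ e)]; [exists e' | rewrite ev].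
Qed.

Definition tree_scheme : routing_scheme t := RoutingScheme tree_forward_link.

Lemma first_treeP (P : pred nat) i : i < K -> P i ->
  [/\ first_tree P < K, first_tree P <= i & P (first_tree P)].
Proof.
move=> ltiK Pi; have hasP : has P (iota 0 K).
  by apply/hasP; exists i; rewrite ?mem_iota.
have ltK : first_tree P < K by rewrite -(size_iota 0 K) -has_find.
split=> //; last by have := nth_find 0 hasP; rewrite nth_iota.
by rewrite leqNgt; apply/negP => /(before_find 0); rewrite nth_iota ?Pi.
Qed.

Hypothesis branchT : forall i,
  i < K -> spanning_branching tail head R (T i) (h i).
Hypothesis disjT : forall i j a,
  i < K -> j < K -> a \in T i -> a \in T j -> i = j.
Hypothesis tR : t \in R.
(** A packet outside [R] can thus never get stuck at a root other than [t]. *)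
Hypothesis closedR : forall a : arc,
  tail a \notin R -> (head a == t) || (head a \notin R).

Lemma tree_arc_ex i v : i < K -> v \notin R ->
  exists a, [/\ tree_arc i v = Some a, a \in T i, tail a = v &
                h i (head a) < h i v].
Proof.
move=> ltiK vR; have [decr cov] := branchT ltiK.
have [b bT bv] := cov v vR; rewrite /tree_arc.
case: pickP => [a /andP[aT /eqP av]|/(_ b)]; last by rewrite bT bv eqxx.
by exists a; rewrite -{2}av decr.
Qed.

Lemma first_tree_eq (P : pred nat) i :
  i < K -> P i -> (forall j, j < K -> P j -> j = i) -> first_tree P = i.
Proof. by move=> ltiK Pi uniq; have [ltK _ /uniq->] := first_treeP ltiK Pi. Qed.

Lemma current_tree_arc i a : i < K -> a \in T i ->
  current_tree (head a) (Some a.1) = i.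
Proof.
move=> ltiK aT; apply: first_tree_eq => //.
  by apply/existsP; exists a; rewrite aT !eqxx.
move=> j ltjK /existsP[b /and3P[bT /eqP eab /eqP hab]].
have [decr _] := branchT ltjK; apply: (disjT ltjK ltiK bT).
(* A tree arc is no self-loop, since the height decreases along it. *)
rewrite (eq_arc_head eab hab) //; apply: contraTneq (decr b bT) => ->.
by rewrite ltnn.
Qed.

(** * Delivery under dynamic failures *)

Variables (F : {set link G}) (up : nat -> {set link G}).
Hypothesis up_F : forall i, ~: F \subset up i.

Lemma up_notin n e : e \notin F -> e \in up n.
Proof. by move=> eF; apply: (subsetP (up_F n)); rewrite inE. Qed.

Lemma tree_hop n v p j a :
    v \notin R -> j < K -> next_tree v p (links_at v :&: up n) = j ->
    tree_arc j v = Some a -> a.1 \in up n ->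
    (head a \notin R -> delivered tree_scheme up n.+1 (head a) (Some a.1)) ->
  delivered tree_scheme up n v p.
Proof.
move=> vR ltjK nextj arcj upa deliv; have [_ av] := tree_arc_some arcj.
apply: (@Hop _ _ _ _ _ _ (head a) _ a.1) => //.
- by apply: contraNneq vR => ->.
- by rewrite /= /tree_forward nextj arcj.
- by rewrite -av joins_arc.
have := @closedR a; rewrite av => /(_ vR)/orP[/eqP->|/deliv//].
exact: Arrived.
Qed.

Lemma next_treeP n v p i : v \notin R -> i < K -> current_tree v p <= i ->
    available (links_at v :&: up n) v i ->
  let j := next_tree v p (links_at v :&: up n) in
  exists a, [/\ current_tree v p <= j, j <= i, j < K, tree_arc j v = Some a &
                a.1 \in up n].
Proof.
move=> vR ltiK lei avi; rewrite /next_tree.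
set P := fun i => (_ <= i) && _.
have Pi : P i by rewrite /P lei.
have [ltK leji /andP[lej]] := first_treeP ltiK Pi; rewrite ltK /available.
case E: tree_arc => [a|//]; rewrite inE => /andP[_ upa].
by exists a.
Qed.

Lemma available_up n v i a : tree_arc i v = Some a -> a.1 \in up n ->
  available (links_at v :&: up n) v i.
Proof.
move=> arcv upa; rewrite /available arcv inE upa andbT.
by have [_ <-] := tree_arc_some arcv; apply: link_of_tail.
Qed.

(** Heights decrease along the path, so arcs over [F] that start above [v] are never met. The tree
    need not avoid [F] altogether, which is what the bounce requires. *)
Lemma follow_tree j n v p :
    j < K -> v \notin R -> current_tree v p = j ->
    (forall a, a \in T j -> a.1 \in F -> h j v < h j (tail a)) ->
  delivered tree_scheme up n v p.
Proof.
move=> ltjK; have [m] := ubnP (h j v).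
elim: m n v p => // m IHm n v p lem vR curj above.
have [a [arca aT av lta]] := tree_arc_ex ltjK vR.
have upa : a.1 \in up n.
  apply: up_notin; apply/negP => /(above a aT); by rewrite av ltnn.
have avail := available_up arca upa.
have [|b [le1 le2 _ _ _]] := @next_treeP n v p j vR ltjK _ avail.
  by rewrite curj.
apply: (tree_hop vR ltjK _ arca upa).
  by apply/eqP; rewrite eqn_leq le2 -{1}curj.
move=> hR; apply: IHm => //; first exact: leq_trans lta _.
  exact: current_tree_arc.
by move=> c cT cF; apply: ltn_trans lta (above c cT cF).
Qed.

Hypothesis cardF : #|F|.*2 <= K.

(* There are 2 #|F| <= K arcs over F, so if each of the K disjoint trees
   contains one of them, then each of them is in exactly one tree and each tree
   contains exactly one. *)
Lemma unique_failed_arc :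
    (forall i, i < K -> exists2 a, a \in T i & a.1 \in F) ->
  forall a, a.1 \in F -> exists i,
    [/\ i < K, a \in T i & forall b, b \in T i -> b.1 \in F -> b = a].
Proof.
move=> hit.
have [f fT fF] := fin_all_exists2 (fun i : 'I_K => hit i (ltn_ord i)).
have fI : injective f.
  move=> i j eqf; apply: val_inj; apply: (disjT (ltn_ord i) (ltn_ord j) (fT i)).
  by rewrite eqf fT.
have imf : f @: [set: 'I_K] = setX F [set: bool].
  apply/eqP; rewrite eqEcard; apply/andP; split.
    by apply/subsetP=> _ /imsetP[i _ ->]; rewrite !inE fF.
  by rewrite cardsX card_imset // !cardsT card_ord card_bool muln2.
have ontof a : a.1 \in F -> exists i, a = f i.
  move=> aF; have : a \in f @: [set: 'I_K] by rewrite imf !inE aF.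
  by case/imsetP=> i _ ->; exists i.
move=> a /ontof[i ->]; exists i; split=> // b bT /ontof[j eqb].
rewrite eqb; congr f; apply: val_inj.
apply: (disjT (ltn_ord j) (ltn_ord i) (fT j)).
by rewrite -eqb.
Qed.

(** Lexicographic induction on the number of trees still ahead and the height in the current one,
    until a bounce. The last hypothesis says that no tree avoiding [F] has been passed; it survives
    each hop because such a tree is always available. *)
Lemma tree_scheme_delivers n v p :
    v \notin R -> current_tree v p < K ->
    (forall g, g < K -> (forall a, a \in T g -> a.1 \notin F) ->
       current_tree v p <= g) ->
  delivered tree_scheme up n v p.
Proof.
have [m] := ubnP (K - current_tree v p); elim: m n v p => // m IHm n v p.
have [l] := ubnP (h (current_tree v p) v); elim: l n v p => // l IHl n v p.
set i := current_tree v p => lel lem vR ltiK below.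
set U := links_at v :&: up n.
case: (boolP [exists j : 'I_K, (i <= j) && available U v j]).
  case/existsP=> j /andP[leij avj].
  have [a []] := next_treeP vR (ltn_ord j) leij avj.
  set j' := next_tree _ _ _ => leij' _ ltj' arca upa.
  have [aT av] := tree_arc_some arca.
  have cura : current_tree (head a) (Some a.1) = j' by apply: current_tree_arc.
  have below' g : g < K -> (forall a, a \in T g -> a.1 \notin F) -> j' <= g.
    move=> ltg good; have [b [arcb bT _ _]] := tree_arc_ex ltg vR.
    have avg := available_up arcb (up_notin n (good b bT)).
    by have [c []] := next_treeP vR ltg (below g ltg good) avg.
  apply: (tree_hop vR ltj' (erefl _) arca upa) => hR.
  case: (eqVneq i j') => [eqi|neqi].
    apply: IHl; rewrite ?cura -?eqi // ?eqi //.
    have [decr _] := branchT ltj'; have := decr a aT; rewrite av -eqi; lia.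
  by apply: IHm; rewrite ?cura //; lia.
rewrite negb_exists => /forallP none.
(* A tree avoiding [F] would not have been passed yet and would be available. *)
have hit g : g < K -> exists2 a, a \in T g & a.1 \in F.
  move=> ltg; case: (boolP [exists a in T g, a.1 \in F]).
    by case/existsP=> a /andP[aT aF]; exists a.
  rewrite negb_exists => /forallP good; case/negP: (none (Ordinal ltg)) => /=.
  have good' a : a \in T g -> a.1 \notin F.
    by move=> aT; have := good a; rewrite aT.
  rewrite below //=; have [b [arcb bT _ _]] := tree_arc_ex ltg vR.
  exact: available_up arcb (up_notin n (good' b bT)).
have ltL : K.-1 < K by lia.
have [a [arca aT av lta]] := tree_arc_ex ltL vR.
have aF : a.1 \in F.
  apply: contraNT (none (Ordinal ltL)) => aF /=.
  rewrite (available_up arca (up_notin n aF)) andbT; lia.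
have [j [ltj raT uniq]] := unique_failed_arc hit (a := reverse a) aF.
have nextj : next_tree v p (links_at v :&: up n) = j.
  rewrite /next_tree -/i; case: ifP => [lt|_].
    set P := (X in first_tree X) in lt.
    have : has P (iota 0 K) by rewrite has_find size_iota.
    case/hasP=> g; rewrite mem_iota => /andP[_ ltg] Pg.
    by case/negP: (none (Ordinal ltg)).
  rewrite /bounce_tree arca; apply: first_tree_eq => // g ltg raTg.
  exact: disjT raTg raT.
have [b [arcb bT bv ltb]] := tree_arc_ex ltj vR.
(* Otherwise [b] is [reverse a], whose tail is the head of [a] and hence differs from [v]. *)
have bF : b.1 \notin F.
  apply/negP => /(uniq b bT) eqb; move: lta.
  by rewrite -[head a]/(tail (reverse a)) -eqb bv ltnn.
apply: (tree_hop vR ltj nextj arcb (up_notin n bF)) => hR.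
(* The only arc of [T j] over [F] is [reverse a]; it enters [v], so its tail is higher than [v] and
   than the head of [b]. *)
apply: (follow_tree _ ltj hR (current_tree_arc ltj bT)) => c cT /(uniq c cT) ->.
apply: ltn_trans ltb _; have [decr _] := branchT ltj.
by have := decr _ raT; rewrite head_reverse av.
Qed.

End Routing.

(** * From edge-connectivity to the cut condition, and the conclusion *)

Lemma connected_exits (G : multigraph) (F : {set link G})
    (X : {set vertex G}) u v :
    connected_without F u v -> u \in X -> v \notin X ->
  exists a : arc G, [/\ a.1 \notin F, tail a \in X & head a \notin X].
Proof.
case/connectP=> p; elim: p u => [|w p IHp] u /= => [_ -> ->//|].
case/andP=> /adj_withoutP[a [aF <- hw]] pathp eqv uX vX.
case: (boolP (w \in X)) => [wX|wX]; first exact: IHp pathp eqv wX vX.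
by exists a; rewrite hw.
Qed.

Theorem theorem6 (k : nat) (G : multigraph) (t : vertex G) :
  k_edge_connected k G ->
  exists R : routing_scheme t, dynamically_resilient (k %/ 2) R.
Proof.
move=> conG.
(* For k = 0 the graph may be disconnected; a single branching spanning the
   component of [t] then serves, obtained by making all other vertices roots. *)
pose K := maxn k 1.
pose R := [set v | (v == t) || ~~ connected_without set0 v t].
have tR : t \in R by rewrite inE eqxx.
have conK : rooted_connected (@tail G) (@head G) R K setT.
  move=> X /set0Pn[v vX] XR; rewrite leqNgt; apply/negP => ltK.
  pose F := [set a.1 | a in leaving (@tail G) (@head G) setT X].
  have leF : #|F| < K by apply: leq_ltn_trans ltK; apply: leq_imset_card.
  have vt : connected_without F v t.
    case: (ltnP #|F| k) => [ltF|geF]; first exact: conG.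
    (* Only [k = 0] and [K = 1] is left; the path to [t] then comes from [v] lying outside [R]. *)
    have -> : F = set0 by apply: cards0_eq; rewrite /K in leF; lia.
    by have := disjointFr XR vX; rewrite inE => /norP[_ /negbNE].
  have tX : t \notin X by rewrite (disjointFl XR tR).
  have [a [aF aX hX]] := connected_exits vt vX tX.
  by case/negP: aF; apply: imset_f; rewrite !inE aX.
have [T [h [_ brT disT]]] := disjoint_branchings conK.
have closedR (a : arc G) :
    tail a \notin R -> (head a == t) || (head a \notin R).
  rewrite !inE => /norP[_ /negbNE ct]; case: eqP => //= _; rewrite negbK.
  apply: connect_trans ct; apply: connect1; apply/adj_withoutP.
  by exists (reverse a); rewrite inE head_reverse.
exists (tree_scheme t K T) => F leF up upF s st.
case: (eqVneq s t) => [->|snt]; first exact: Arrived.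
apply: (tree_scheme_delivers brT disT tR closedR upF).
- by rewrite /K; lia.
- rewrite inE negb_or snt negbK; apply: connect_sub st => u v.
  case/adj_withoutP=> a [_ <- <-]; apply: connect1; apply/adj_withoutP.
  by exists a; rewrite inE.
- by rewrite /= /K; lia.
- by [].
Qed.
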